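(* Let $T:V\to L$ be a relative Rota-Baxter operator on a (right) Leibniz algebra $(L,[\cdot,\cdot]_L)$ with respect to a representation $(V;\rho^l,\rho^r)$. Let $\phi\in Z^2_T(V,L)$ be a $2$-cocycle of the Leibniz algebra $(V,[\cdot,\cdot]_T)$ with coefficients in $(L;\rho^l_T,\rho^r_T)$. Then $\omega(u,v,w)=\phi([u,v]_T,w)+\rho^r_T(w)\phi(u,v)$ is a $3$-cocycle of the Leibniz triple system $(V,\{\cdot,\cdot,\cdot\}_T=[[\cdot,\cdot]_T,\cdot]_T)$ with respect to the representation $(R_T,M_T,L_T)$ on $L$.
   Context: All vector spaces are over a fixed arbitrary field. A (right) Leibniz algebra is a vector space $L$ with a bilinear bracket satisfying $[x,[y,z]_L]_L=[[x,y]_L,z]_L-[[x,z]_L,y]_L$. A representation $(V;\rho^l,\rho^r)$ of $L$ consists of a vector space $V$ and linear maps $\rho^l,\rho^r:L\to\mathfrak{gl}(V)$ with, for all $x,y\in L$: $\rho^l([x,y]_L)=\rho^r(y)\rho^l(x)-\rho^l(x)\rho^r(y)$, $\rho^l([x,y]_L)=\rho^l(x)\rho^l(y)+\rho^r(y)\rho^l(x)$, $\rho^r([x,y]_L)=\rho^r(y)\rho^r(x)-\rho^r(x)\rho^r(y)$. A relative Rota-Baxter operator on $L$ with respect to $(V;\rho^l,\rho^r)$ is a linear map $T:V\to L$ with $[Tu,Tv]_L=T(\rho^l(Tu)v+\rho^r(Tv)u)$ for all $u,v\in V$. Then $V$ is a Leibniz algebra with $[u,v]_T=\rho^l(Tu)v+\rho^r(Tv)u$,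 with a representation $(L;\rho^l_T,\rho^r_T)$ given by $\rho^l_T(u)x=[Tu,x]_L-T\rho^r(x)u$, $\rho^r_T(u)x=[x,Tu]_L-T\rho^l(x)u$ ($u\in V$, $x\in L$). $Z^2_T(V,L)$ is the space of bilinear maps $\phi:V\times V\to L$ such that for all $u,v,w\in V$: $\rho^l_T(u)\phi(v,w)-\rho^r_T(w)\phi(u,v)+\rho^r_T(v)\phi(u,w)+\phi(u,[v,w]_T)-\phi([u,v]_T,w)+\phi([u,w]_T,v)=0$. $(V,\{\cdot,\cdot,\cdot\}_T)$ with $\{u,v,w\}_T=[[u,v]_T,w]_T$ is a Leibniz triple system, with representation $(R_T,M_T,L_T)$ on $L$, where $R_T(u,v)x=\rho^r_T(v)\rho^r_T(u)x$, $M_T(u,v)x=\rho^r_T(v)\rho^l_T(u)x$, $L_T(u,v)x=\rho^l_T([u,v]_T)x$. (A Leibniz triple system is a vector space with a trilinear product satisfying $\{a,b,\{c,d,e\}\}=\{\{a,b,c\},d,e\}-\{\{a,b,d\},c,e\}-\{\{a,b,e\},c,d\}+\{\{a,b,e\},d,c\}$ and $\{a,\{b,c,d\},e\}=\{\{a,b,c\},d,e\}-\{\{a,c,b\},d,e\}-\{\{a,d,b\},c,e\}+\{\{a,d,c\},b,e\}$; a triple $(r,m,l)$ of bilinear maps from it to $\mathrm{End}(W)$ is a representation on $W$ iff the direct sum with product $\{x+u,y+v,z+w\}=\{x,y,z\}+l(x,y)w+m(x,z)v+r(y,z)u$ is again a Leibniz triple system.) A $3$-cocycle of the Leibniz triple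 system $(V,\{\cdot,\cdot,\cdot\}_T)$ with respect to $(R_T,M_T,L_T)$ is a trilinear map $g:V^3\to L$ with $\partial^3_1g=\partial^3_2g=0$, where $\partial^3_1g(v_1,\dots,v_5)=g(v_1,v_2,\{v_3,v_4,v_5\}_T)-g(\{v_1,v_2,v_3\}_T,v_4,v_5)+g(\{v_1,v_2,v_4\}_T,v_3,v_5)+g(\{v_1,v_2,v_5\}_T,v_3,v_4)-g(\{v_1,v_2,v_5\}_T,v_4,v_3)+L_T(v_1,v_2)g(v_3,v_4,v_5)-R_T(v_4,v_5)g(v_1,v_2,v_3)+R_T(v_3,v_5)g(v_1,v_2,v_4)+R_T(v_3,v_4)g(v_1,v_2,v_5)-R_T(v_4,v_3)g(v_1,v_2,v_5)$, $\partial^3_2g(v_1,\dots,v_5)=g(v_1,\{v_2,v_3,v_4\}_T,v_5)-g(\{v_1,v_2,v_3\}_T,v_4,v_5)+g(\{v_1,v_3,v_2\}_T,v_4,v_5)+g(\{v_1,v_4,v_2\}_T,v_3,v_5)-g(\{v_1,v_4,v_3\}_T,v_2,v_5)+M_T(v_1,v_5)g(v_2,v_3,v_4)-R_T(v_4,v_5)g(v_1,v_2,v_3)+R_T(v_4,v_5)g(v_1,v_3,v_2)+R_T(v_3,v_5)g(v_1,v_4,v_2)-R_T(v_2,v_5)g(v_1,v_4,v_3)$. *)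

(* Defs.v *)
From HB Require Import structures.
From mathcomp Require Import all_boot all_order all_algebra.

Set Implicit Arguments.
Unset Strict Implicit.
Unset Printing Implicit Defensive.

Import GRing.Theory.
Local Open Scope ring_scope.

(* Closes an equation between signed sums in a zmodType whose two sides agree
   up to commutativity and cancellation. *)
Ltac zmod_cancel :=
  apply/eqP; rewrite -subr_eq0; apply/eqP;
  rewrite ?(opprD, opprK, addrA) -[LHS]add0r ?addrA;
  repeat match goal with
  | |- 0 = 0 => reflexivity
  | |- ?s - ?a = 0 => rewrite ?(addrAC _ a) subrK
  | |- ?s + ?a = 0 => rewrite ?(addrAC _ (- a)) addrK
  end.

Section Leibniz.
Variable K : fieldType.

Record leibnizAlgebra := LeibnizAlgebra {
  leib_sort :> lmodType K;
  leib_br : {bilinear leib_sort -> leib_sort -> leib_sort};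
  leib_brA : forall x y z,
    leib_br x (leib_br y z) =
      leib_br (leib_br x y) z - leib_br (leib_br x z) y }.

Record leibnizRep (L : leibnizAlgebra) := LeibnizRep {
  lrep_sort :> lmodType K;
  rhol : {bilinear L -> lrep_sort -> lrep_sort};
  rhor : {bilinear L -> lrep_sort -> lrep_sort};
  rhol_br1 : forall x y v,
    rhol (leib_br L x y) v = rhor y (rhol x v) - rhol x (rhor y v);
  rhol_br2 : forall x y v,
    rhol (leib_br L x y) v = rhol x (rhol y v) + rhor y (rhol x v);
  rhor_br : forall x y v,
    rhor (leib_br L x y) v = rhor y (rhor x v) - rhor x (rhor y v) }.

Definition leibniz_2cocycle (A : leibnizAlgebra) (M : leibnizRep A)
    (phi : {bilinear A -> A -> M}) : Prop :=
  forall u v w,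
    rhol M u (phi v w) - rhor M w (phi u v) + rhor M v (phi u w)
      + phi u (leib_br A v w) - phi (leib_br A u v) w
      + phi (leib_br A u w) v = 0.

Definition trilinear (U1 U2 U3 W : lmodType K) (f : U1 -> U2 -> U3 -> W) : Prop :=
  [/\ forall y z, linear (fun x => f x y z),
      forall x z, linear (fun y => f x y z)
    & forall x y, linear (f x y)].

Definition lts_axiom1 (S : lmodType K) (t : S -> S -> S -> S) : Prop :=
  forall a b c d e,
    t a b (t c d e) =
      t (t a b c) d e - t (t a b d) c e - t (t a b e) c d + t (t a b e) d c.

Definition lts_axiom2 (S : lmodType K) (t : S -> S -> S -> S) : Prop :=
  forall a b c d e,
    t a (t b c d) e =
      t (t a b c) d e - t (t a c b) d e - t (t a d b) c e + t (t a d c) b e.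

Definition is_lts (S : lmodType K) (t : S -> S -> S -> S) : Prop :=
  [/\ trilinear t, lts_axiom1 t & lts_axiom2 t].

Record leibnizTriple := LeibnizTriple {
  lts_sort :> lmodType K;
  lts_br : lts_sort -> lts_sort -> lts_sort -> lts_sort;
  lts_brP : is_lts lts_br }.

Definition lts_dsum (S W : lmodType K) (t : S -> S -> S -> S)
    (r m l : S -> S -> W -> W) (p q s : S * W) : S * W :=
  (t p.1 q.1 s.1, l p.1 q.1 s.2 + m p.1 s.1 q.2 + r q.1 s.1 p.2).

Arguments lts_br : clear implicits.

(* A bilinear map S * S -> End(W) is rendered as a trilinear map
   S * S * W -> W. *)
Record ltsRep (S : leibnizTriple) := LtsRep {
  ltsrep_sort :> lmodType K;
  ltsR : S -> S -> ltsrep_sort -> ltsrep_sort;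
  ltsM : S -> S -> ltsrep_sort -> ltsrep_sort;
  ltsL : S -> S -> ltsrep_sort -> ltsrep_sort;
  ltsR_tri : trilinear ltsR;
  ltsM_tri : trilinear ltsM;
  ltsL_tri : trilinear ltsL;
  ltsrepP : is_lts (lts_dsum (lts_br S) ltsR ltsM ltsL) }.

Arguments ltsR {S} l.
Arguments ltsM {S} l.
Arguments ltsL {S} l.

Section Cochains.
Variables (S : leibnizTriple) (W : ltsRep S).
Local Notation t := (lts_br S).
Local Notation R := (ltsR W).
Local Notation M := (ltsM W).
Local Notation L := (ltsL W).

Definition lts_d31 (g : S -> S -> S -> W) (v1 v2 v3 v4 v5 : S) : W :=
  g v1 v2 (t v3 v4 v5) - g (t v1 v2 v3) v4 v5 + g (t v1 v2 v4) v3 v5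
  + g (t v1 v2 v5) v3 v4 - g (t v1 v2 v5) v4 v3
  + L v1 v2 (g v3 v4 v5) - R v4 v5 (g v1 v2 v3) + R v3 v5 (g v1 v2 v4)
  + R v3 v4 (g v1 v2 v5) - R v4 v3 (g v1 v2 v5).

Definition lts_d32 (g : S -> S -> S -> W) (v1 v2 v3 v4 v5 : S) : W :=
  g v1 (t v2 v3 v4) v5 - g (t v1 v2 v3) v4 v5 + g (t v1 v3 v2) v4 v5
  + g (t v1 v4 v2) v3 v5 - g (t v1 v4 v3) v2 v5
  + M v1 v5 (g v2 v3 v4) - R v4 v5 (g v1 v2 v3) + R v4 v5 (g v1 v3 v2)
  + R v3 v5 (g v1 v4 v2) - R v2 v5 (g v1 v4 v3).

Definition lts_3cocycle (g : S -> S -> S -> W) : Prop :=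
  [/\ trilinear g,
      forall v1 v2 v3 v4 v5, lts_d31 g v1 v2 v3 v4 v5 = 0
    & forall v1 v2 v3 v4 v5, lts_d32 g v1 v2 v3 v4 v5 = 0].

End Cochains.

Section TripleOfLeibniz.
Variables (A : leibnizAlgebra) (M : leibnizRep A).
Local Notation "[[ x , y ]]" := (leib_br A x y).

Definition leib_triple (x y z : A) : A := [[ [[x, y]], z]].

Lemma leib_triple_lts : is_lts leib_triple.
Proof.
rewrite /leib_triple; split; first split.
- by move=> y z a x x' /=; rewrite !linearPl.
- by move=> x z a y y' /=; rewrite !(linearPr, linearPl).
- by move=> x y a z z' /=; rewrite !linearPr.
- move=> a b c d e; set p := [[a, b]].
  rewrite (leib_brA p) (leib_brA p c d) (leib_brA [[p, e]] c d).
  rewrite linearBl; zmod_cancel.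
- move=> a b c d e.
  rewrite (leib_brA a) (leib_brA a b c) (leib_brA [[a, d]] b c).
  rewrite !(linearBl, linearBr, linearNl); zmod_cancel.
Qed.

Definition lts_of_leibniz : leibnizTriple := LeibnizTriple leib_triple_lts.

Definition rep_R (u v : A) (x : M) : M := rhor M v (rhor M u x).
Definition rep_M (u v : A) (x : M) : M := rhor M v (rhol M u x).
Definition rep_L (u v : A) (x : M) : M := rhol M [[u, v]] x.

Lemma rep_R_tri : trilinear rep_R.
Proof.
rewrite /rep_R; split=> x y a z z' /=.
- by rewrite linearPl linearPr.
- by rewrite linearPl.
- by rewrite !linearPr.
Qed.

Lemma rep_M_tri : trilinear rep_M.
Proof.
rewrite /rep_M; split=> x y a z z' /=.
- by rewrite linearPl linearPr.
- by rewrite linearPl.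
- by rewrite !linearPr.
Qed.

Lemma rep_L_tri : trilinear rep_L.
Proof.
rewrite /rep_L; split=> x y a z z' /=.
- by rewrite !linearPl.
- by rewrite linearPr linearPl.
- by rewrite linearPr.
Qed.

End TripleOfLeibniz.

Section SemiDirect.
Variables (A : leibnizAlgebra) (M : leibnizRep A).

Definition sd_br (p q : (A * M)%type) : (A * M)%type :=
  (leib_br A p.1 q.1, rhol M p.1 q.2 + rhor M q.1 p.2).

Lemma sd_br_bilinear : bilinear_for *:%R *:%R sd_br.
Proof.
split=> [q a p p'|p a q q']; congr (_, _);
  rewrite /= ?linearPl ?linearPr //= !scalerDr; zmod_cancel.
Qed.

HB.instance Definition _ :=
  bilinear_isBilinear.Build K _ _ _ *:%R *:%R sd_br sd_br_bilinear.

Lemma sd_brA p q s :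
  sd_br p (sd_br q s) = sd_br (sd_br p q) s - sd_br (sd_br p s) q.
Proof.
congr (_, _); rewrite /=; first exact: leib_brA.
rewrite !linearDr rhor_br (rhol_br2 p.1 q.1) (rhol_br1 p.1 s.1).
zmod_cancel.
Qed.

Definition sd_leibniz : leibnizAlgebra :=
  @LeibnizAlgebra (A * M)%type sd_br sd_brA.

Lemma eq_is_lts (S : lmodType K) (t t' : S -> S -> S -> S) :
  (forall x y z, t x y z = t' x y z) -> is_lts t -> is_lts t'.
Proof.
move=> E [[t1 t2 t3] a1 a2]; split; first split.
- by move=> y z a x x'; rewrite -!E; apply: t1.
- by move=> x z a y y'; rewrite -!E; apply: t2.
- by move=> x y a z z'; rewrite -!E; apply: t3.
- by move=> a b c d e; rewrite -!E; apply: a1.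
- by move=> a b c d e; rewrite -!E; apply: a2.
Qed.

Lemma lts_rep_dsum :
  is_lts (lts_dsum (@leib_triple A) (@rep_R A M) (@rep_M A M) (@rep_L A M)).
Proof.
apply: (eq_is_lts _ (leib_triple_lts sd_leibniz)) => p q s.
by congr (_, _); rewrite /= linearDr addrA.
Qed.

Definition lts_rep_of_leibniz : ltsRep (lts_of_leibniz A) :=
  @LtsRep (lts_of_leibniz A) M (@rep_R A M) (@rep_M A M) (@rep_L A M)
    (@rep_R_tri A M) (@rep_M_tri A M) (@rep_L_tri A M) lts_rep_dsum.

End SemiDirect.

Record relRotaBaxter (L : leibnizAlgebra) (V : leibnizRep L) := RelRotaBaxter {
  rrb_fun :> {linear V -> L};
  rrbP : forall u v,
    leib_br L (rrb_fun u) (rrb_fun v) =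
      rrb_fun (rhol V (rrb_fun u) v + rhor V (rrb_fun v) u) }.

Section Descendent.
Variables (L : leibnizAlgebra) (V : leibnizRep L) (T : relRotaBaxter V).
Local Notation "[[ x , y ]]" := (leib_br L x y).
Local Notation rl := (rhol V).
Local Notation rr := (rhor V).

Let TP a u v : T (a *: u + v) = a *: T u + T v. Proof. exact: linearP. Qed.

Let rhol_rhol x y v : rl x (rl y v) = - rl x (rr y v).
Proof.
by have /eqP := rhol_br2 x y v; rewrite rhol_br1 addrC (inj_eq (addIr _)) => /eqP <-.
Qed.

Definition desc_br (u v : V) : V := rl (T u) v + rr (T v) u.

Lemma desc_br_bilinear : bilinear_for *:%R *:%R desc_br.
Proof.
split=> [v a u u'|u a v v']; rewrite /desc_br TP linearPl linearPr /= scalerDr;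
  zmod_cancel.
Qed.

HB.instance Definition _ :=
  bilinear_isBilinear.Build K _ _ _ *:%R *:%R desc_br desc_br_bilinear.

Let T_desc u v : T (desc_br u v) = [[T u, T v]].
Proof. by rewrite rrbP. Qed.

Lemma desc_brA u v w :
  desc_br u (desc_br v w) = desc_br (desc_br u v) w - desc_br (desc_br u w) v.
Proof.
rewrite {1 3 5}/desc_br !T_desc /desc_br !linearDr !(rhol_br1, rhor_br, rhol_rhol).
zmod_cancel.
Qed.

Definition descendent : leibnizAlgebra := @LeibnizAlgebra V desc_br desc_brA.

Definition desc_rhol (u : V) (x : L) : L := [[T u, x]] - T (rr x u).
Definition desc_rhor (u : V) (x : L) : L := [[x, T u]] - T (rl x u).

Lemma desc_rhol_bilinear : bilinear_for *:%R *:%R desc_rhol.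
Proof.
split=> [x a u u'|u a x x']; rewrite /desc_rhol.
  rewrite TP (linearPl (leib_br L)) (linearPr (rhor V)) TP /= scalerBr; zmod_cancel.
rewrite (linearPr (leib_br L)) (linearPl (rhor V)) TP /= scalerBr; zmod_cancel.
Qed.

Lemma desc_rhor_bilinear : bilinear_for *:%R *:%R desc_rhor.
Proof.
split=> [x a u u'|u a x x']; rewrite /desc_rhor.
  rewrite TP (linearPr (leib_br L)) (linearPr (rhol V)) TP /= scalerBr; zmod_cancel.
rewrite (linearPl (leib_br L)) (linearPl (rhol V)) TP /= scalerBr; zmod_cancel.
Qed.

HB.instance Definition _ :=
  bilinear_isBilinear.Build K _ _ _ *:%R *:%R desc_rhol desc_rhol_bilinear.
HB.instance Definition _ :=
  bilinear_isBilinear.Build K _ _ _ *:%R *:%R desc_rhor desc_rhor_bilinear.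

Let TD : {morph T : x y / x + y}. Proof. exact: linearD. Qed.
Let TN : {morph T : x / - x}. Proof. exact: linearN. Qed.
Let desc_norm := (linearDr, linearDl, linearNr, linearNl, rrbP,
  @leib_brA L, @rhol_br1 L V, @rhor_br L V, rhol_rhol, TD, TN).

Lemma desc_rhol_br1 u v x :
  desc_rhol (desc_br u v) x =
    desc_rhor v (desc_rhol u x) - desc_rhol u (desc_rhor v x).
Proof.
rewrite /desc_rhol /desc_rhor T_desc /desc_br !desc_norm; zmod_cancel.
Qed.

Lemma desc_rhol_br2 u v x :
  desc_rhol (desc_br u v) x =
    desc_rhol u (desc_rhol v x) + desc_rhor v (desc_rhol u x).
Proof.
rewrite /desc_rhol /desc_rhor T_desc /desc_br !desc_norm; zmod_cancel.
Qed.

Lemma desc_rhor_br u v x :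
  desc_rhor (desc_br u v) x =
    desc_rhor v (desc_rhor u x) - desc_rhor u (desc_rhor v x).
Proof.
rewrite /desc_rhol /desc_rhor T_desc /desc_br !desc_norm; zmod_cancel.
Qed.

Definition descendentRep : leibnizRep descendent :=
  @LeibnizRep descendent L desc_rhol desc_rhor
    desc_rhol_br1 desc_rhol_br2 desc_rhor_br.

End Descendent.
End Leibniz.

Arguments lts_br {K} l.
Arguments ltsR {K S} l.
Arguments ltsM {K S} l.
Arguments ltsL {K S} l.

(* Main.v *)
Require Import Defs.
From HB Require Import structures.
From mathcomp Require Import all_boot all_order all_algebra.

Set Implicit Arguments.
Unset Strict Implicit.
Unset Printing Implicit Defensive.

Import GRing.Theory.
Local Open Scope ring_scope.

(** Cocycles are the same thing as abelian extensions, and passing from a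
    Leibniz algebra to its triple system turns an extension into an extension.
    A bilinear map [phi] from [A * A] to a representation [M] of a Leibniz
    algebra [A] twists the semidirect product into the bracket
      [(x, m), (y, n)] = ([x, y], x.n + m.y + phi(x, y)),
    and the cocycle condition on [phi] is the Leibniz identity for this bracket
    ([ext_brA]).  The extension then carries the triple product [[p, q], s],
    which is a Leibniz triple system ([leib_triple_lts]).  Expanding it, its
    [M]-component is the action of the induced triple representation plus
      phi([x, y], z) + phi(x, y).z,
    so it is the triple extension of [A] by [M] twisted by exactly this map,
    [triple_cochain], which is the one in the theorem.  The two axioms of a
    Leibniz triple system, read in the [M]-component of elements [(v, 0)], are
    the two equations of a 3-cocycle ([twisted_dsum_3cocycle]).

    The theorem is the case where [A] is the descendent algebra on [V] and [M]
    is its representation on [L]. *)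

Lemma trilinear_r0 (K : fieldType) (U1 U2 U3 W : lmodType K)
    (f : U1 -> U2 -> U3 -> W) x y : trilinear f -> f x y 0 = 0.
Proof.
by case=> _ _ lin; have := lin x y (-1) 0 0; rewrite !scaleN1r !addNr.
Qed.

Section TripleExtension.
Variables (K : fieldType) (S : leibnizTriple K) (W : ltsRep S).

Definition twisted_dsum (g : S -> S -> S -> W) (p q s : S * W) : S * W :=
  lts_dsum (lts_br S) (ltsR W) (ltsM W) (ltsL W) p q s
    + (0, g p.1 q.1 s.1).

(** The [W]-component of a product of vectors [(v, 0)] is a value of [g]. So a
    nested product of such vectors has in its [W]-component the value of [g] at
    the inner product, plus the inner value of [g] acted on by [R], [M] or [L]
    according as the inner product stands first, second or third.  The two
    axioms thus become [lts_d31 g = 0] and [lts_d32 g = 0]. *)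
Lemma twisted_dsum_3cocycle (g : S -> S -> S -> W) :
  trilinear g -> is_lts (twisted_dsum g) -> lts_3cocycle g.
Proof.
have R0 x y := trilinear_r0 x y (ltsR_tri W).
have M0 x y := trilinear_r0 x y (ltsM_tri W).
have L0 x y := trilinear_r0 x y (ltsL_tri W).
move=> g_tri [_ ax1 ax2]; split=> // v1 v2 v3 v4 v5.
- have /(congr1 snd) := ax1 (v1, 0) (v2, 0) (v3, 0) (v4, 0) (v5, 0).
  rewrite /= !(R0, M0, L0, addr0, add0r) => /eqP; rewrite -subr_eq0 => /eqP E.
  by rewrite -[RHS]E /lts_d31; zmod_cancel.
- have /(congr1 snd) := ax2 (v1, 0) (v2, 0) (v3, 0) (v4, 0) (v5, 0).
  rewrite /= !(R0, M0, L0, addr0, add0r) => /eqP; rewrite -subr_eq0 => /eqP E.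
  by rewrite -[RHS]E /lts_d32; zmod_cancel.
Qed.

End TripleExtension.

Section LeibnizExtension.
Variables (K : fieldType) (A : leibnizAlgebra K) (M : leibnizRep A).
Variable phi : {bilinear A -> A -> M}.

Definition ext_br (p q : (A * M)%type) : (A * M)%type :=
  sd_br p q + (0, phi p.1 q.1).

Lemma ext_br_bilinear : bilinear_for *:%R *:%R ext_br.
Proof.
split=> [q a p p'|p a q q']; rewrite /ext_br /=.
- rewrite linearPl scalerDr addrACA; congr (_ + _).
  by congr (_, _); rewrite /= ?scaler0 ?addr0 // linearPl.
- rewrite linearPr scalerDr addrACA; congr (_ + _).
  by congr (_, _); rewrite /= ?scaler0 ?addr0 // linearPr.
Qed.

HB.instance Definition _ :=
  bilinear_isBilinear.Build K _ _ _ *:%R *:%R ext_br ext_br_bilinear.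

Hypothesis phi_cocycle : leibniz_2cocycle phi.

(** The terms free of [phi] cancel by the Leibniz identity of the semidirect
    product; the terms in [phi] left over are those of the 2-cocycle
    condition, which is used here solved for [phi u [v, w]]. *)
Lemma ext_brA p q s :
  ext_br p (ext_br q s) = ext_br (ext_br p q) s - ext_br (ext_br p s) q.
Proof.
have phiA u v w : phi u (leib_br A v w) =
    phi (leib_br A u v) w - phi (leib_br A u w) v
      + rhor M w (phi u v) - rhor M v (phi u w) - rhol M u (phi v w).
  by apply/eqP; rewrite -subr_eq0 -(phi_cocycle u v w); apply/eqP; zmod_cancel.
congr (_, _); rewrite /= ?addr0; first exact: leib_brA.
rewrite phiA !linearDr /= rhor_br (rhol_br2 p.1 q.1) (rhol_br1 p.1 s.1).
zmod_cancel.
Qed.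

Definition ext_leibniz : leibnizAlgebra K :=
  @LeibnizAlgebra K (A * M)%type ext_br ext_brA.

Definition triple_cochain (u v w : A) : M :=
  phi (leib_br A u v) w + rhor M w (phi u v).

Lemma triple_cochain_tri : trilinear triple_cochain.
Proof.
rewrite /triple_cochain; split=> [v w a u u'|u w a v v'|u v a w w'].
- rewrite !(linearPl, linearPr) /= scalerDr; zmod_cancel.
- rewrite !(linearPl, linearPr) /= scalerDr; zmod_cancel.
- rewrite !(linearPl, linearPr) /= scalerDr; zmod_cancel.
Qed.

(** In [[p, q], s] the new terms come from the outer bracket, as
    [phi([x, y], z)], and from the inner one, as [phi(x, y)] moved by the right
    action of [z]; their sum is the twist of the triple extension. *)
Lemma leib_triple_ext p q s :
  @leib_triple K ext_leibniz p q s =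
    twisted_dsum (W := lts_rep_of_leibniz M) triple_cochain p q s.
Proof.
congr (_, _); rewrite /= !addr0 //.
rewrite !linearDr /= /rep_L /rep_M /rep_R /triple_cochain.
zmod_cancel.
Qed.

Lemma triple_cochain_3cocycle :
  lts_3cocycle (W := lts_rep_of_leibniz M) triple_cochain.
Proof.
apply: twisted_dsum_3cocycle; first exact: triple_cochain_tri.
exact: (eq_is_lts leib_triple_ext (leib_triple_lts ext_leibniz)).
Qed.

End LeibnizExtension.

Theorem theorem6p8 (K : fieldType) (L : leibnizAlgebra K) (V : leibnizRep L)
    (T : relRotaBaxter V) (phi : {bilinear V -> V -> L})
    (hphi : leibniz_2cocycle (M := descendentRep T) phi) :
  lts_3cocycle (W := lts_rep_of_leibniz (descendentRep T))
    (fun u v w : V => phi (leib_br (descendent T) u v) w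
                      + rhor (descendentRep T) w (phi u v)).
Proof. exact: triple_cochain_3cocycle hphi. Qed.
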